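(* Let $B\in\mathbb{R}^{m\times n}$, $p>0$, and let $C\subseteq\mathbb{R}^n$ be asymptotically linear. Then there exists a $\gamma^*>0$ such that for every $\gamma>\gamma^*$ the problems $$\min\{\|Bx\|_0: x\in C\}\quad\text{and}\quad\min\{\psi_\gamma(Bx): x\in C\}$$ share the same optimal solution set (set of global minimizers).
   Context: $\|y\|_0$ denotes the number of nonzero entries of $y$. For $p>0$, $\gamma>0$, $\psi_\gamma(y)=\sum_{i=1}^m\varphi_\gamma(y_i)$ for $y\in\mathbb{R}^m$, where $\varphi_\gamma(t)=\min(\gamma|t|^p,1)$. A nonempty closed set $C\subseteq\mathbb{R}^n$ is asymptotically linear if for each $\rho>0$ and each sequence $\{x^k\}_{k\in\mathbb{N}}$ satisfying $x^k\in C$, $\|x^k\|_2\to+\infty$, $x^k\|x^k\|_2^{-1}\to\bar x$, there exists $k_0\in\mathbb{N}$ such that $x^k-\rho\bar x\in C$ for all $k\ge k_0$. *)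

(* Defs.v *)
From HB Require Import structures.
From mathcomp Require Import all_boot all_order all_algebra.
From mathcomp Require Import all_classical all_reals all_analysis.

Set Implicit Arguments.
Unset Strict Implicit.
Unset Printing Implicit Defensive.

Import Order.TTheory GRing.Theory Num.Theory.
Import numFieldNormedType.Exports.

Local Open Scope classical_set_scope.
Local Open Scope ring_scope.

(* The library norm on matrices is the sup norm, hence this separate
   Euclidean norm; the topology on column vectors is the library's product
   topology, which is the one induced by the Euclidean norm. *)
Definition norm2 {R : realType} {n : nat} (x : 'cV[R]_n) : R :=
  Num.sqrt (\sum_(i < n) x i 0 ^+ 2).

Definition norm0 {R : realType} {m : nat} (y : 'cV[R]_m) : nat :=
  #|[set i : 'I_m | y i 0 != 0]%SET|.

(* For p > 0, the real power satisfies 0 `^ p = 0, as intended for |t|^p. *)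
Definition varphi {R : realType} (p gamma t : R) : R :=
  Num.min (gamma * `|t| `^ p) 1.

Definition psi {R : realType} {m : nat} (p gamma : R) (y : 'cV[R]_m) : R :=
  \sum_(i < m) varphi p gamma (y i 0).

Definition asymptotically_linear {R : realType} {n : nat}
    (C : set 'cV[R]_n) : Prop :=
  [/\ C !=set0, closed C &
    forall (rho : R) (x : nat -> 'cV[R]_n) (xbar : 'cV[R]_n),
      0 < rho ->
      (forall k, C (x k)) ->
      norm2 (x k) @[k --> \oo] --> +oo ->
      (norm2 (x k))^-1 *: x k @[k --> \oo] --> xbar ->
      exists k0 : nat, forall k : nat, (k0 <= k)%N -> C (x k - rho *: xbar)].

Definition argmin {d : Order.disp_t} {T : Type} {Y : porderType d}
    (f : T -> Y) (C : set T) : set T :=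
  [set x | C x /\ forall y, C y -> (f x <= f y)%O].

(* Main.v *)
(** It suffices to find [delta > 0] such that every [x] in [C] admits a [z] in
    [C] with [norm0 (B z) <= #{i : |(B x)_i| > delta}]: once
    [gamma * delta^p >= 1], entries larger than [delta] contribute exactly [1]
    to [psi], so this cardinal is at most [psi (B x)], while [psi <= norm0]
    always.

    There are finitely many index sets, so such a [delta] exists as soon as,
    for each index set [I], rows [I] of [B x] being arbitrarily small on [C]
    forces them to vanish somewhere on [C].  Take points of [C] with small rows
    [I] and almost minimal Euclidean norm.  If these norms were unbounded, a
    limit [xbar] of the normalized points would satisfy [(B xbar)_I = 0], and
    stepping back by [xbar], which asymptotic linearity allows, would keep rows
    [I] unchanged and shorten the points too much.  Hence the points can be
    chosen bounded, and a limit point works. *)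

Require Import Defs.
From mathcomp Require Import all_boot all_order all_algebra.
From mathcomp Require Import all_classical all_reals all_analysis.
From mathcomp Require Import lra ring.
Import Order.TTheory GRing.Theory Num.Theory.
Import numFieldNormedType.Exports.
Local Open Scope classical_set_scope.
Local Open Scope ring_scope.

Set Implicit Arguments.
Unset Strict Implicit.

(** * Euclidean norm, limits and convergent subsequences *)

Lemma cvg_dot (R : realType) (n : nat) (u v : nat -> 'cV[R]_n)
    (x y : 'cV[R]_n) :
  u @ \oo --> x -> v @ \oo --> y ->
  \sum_i u k i 0 * v k i 0 @[k --> \oo] --> \sum_i x i 0 * y i 0.
Proof.
move=> ux vy; apply: cvg_big => [|i _]; first exact: add_continuous.
have coord (w : nat -> 'cV[R]_n) (z : 'cV[R]_n) :
    w @ \oo --> z -> w k i 0 @[k --> \oo] --> z i 0.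
  move=> wz; apply: (@cvg_comp _ _ _ w (fun z : 'cV[R]_n => z i 0)).
    exact: wz.
  exact: (@coord_continuous R n 1 i 0 z).
by apply: cvgM; exact: coord.
Qed.

Lemma norm2_ge0 (R : realType) (n : nat) (x : 'cV[R]_n) : 0 <= norm2 x.
Proof. exact: sqrtr_ge0. Qed.

Lemma sqr_norm2 (R : realType) (n : nat) (x : 'cV[R]_n) :
  norm2 x ^+ 2 = \sum_i x i 0 * x i 0.
Proof.
by rewrite sqr_sqrtr ?sumr_ge0// => i _; rewrite ?expr2// sqr_ge0.
Qed.

Lemma abs_coord_le_norm2 (R : realType) (n : nat) (x : 'cV[R]_n) (i : 'I_n) :
  `|x i 0| <= norm2 x.
Proof.
rewrite -sqrtr_sqr ler_wsqrtr// (bigD1 i)//= lerDl.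
by apply: sumr_ge0 => j _; exact: sqr_ge0.
Qed.

(** Boxes of row vectors are compact, hence the transposes. The bound [j <= s j] replaces
    monotonicity of [s]: it already sends [s j] to infinity. *)
Lemma bounded_subsequence (R : realType) (n : nat) (M : R)
    (x : nat -> 'cV[R]_n) :
  (forall k, norm2 (x k) <= M) ->
  exists (z : 'cV[R]_n) (s : nat -> nat),
    (forall j, (j <= s j)%N) /\ x (s j) @[j --> \oo] --> z.
Proof.
move=> xM.
have Kco : compact [set v : 'rV[R]_n | forall i, `[- M, M]%classic (v 0 i)].
  by apply: (@rV_compact R n (fun=> `[- M, M]%classic)) => i;
    exact: segment_compact.
have [|v [_ vcl]] := Kco ((fun k => (x k)^T) @ \oo).
  exists 0%N => // k _ i; rewrite /= mxE in_itv/= -ler_norml.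
  exact: le_trans (abs_coord_le_norm2 _ _) (xM k).
have sP j : exists k, (j <= k)%N /\ ball v j.+1%:R^-1 (x k)^T.
  have [||w [[k jk <-] vk]] := vcl [set (x k)^T | k in [set k | (j <= k)%N]]
      (ball v j.+1%:R^-1).
  - by exists j => // k /= jk; exists k.
  - by apply: nbhsx_ballx; rewrite invr_gt0.
  by exists k.
have [s /all_and2[js vs]] := choice sP.
exists v^T, s; split => //; apply/cvg_ballP => e e0.
near=> j; split => // i k; rewrite mxE ord1.
have := vs j; case => _ /(_ 0 i); rewrite mxE; apply: le_ball.
apply: ltW; near: j; exact: (near_infty_natSinv_lt (PosNum e0)).
Unshelve. all: by end_near. Qed.

Lemma cvg_mulmx_coord (R : realType) (m n : nat) (A : 'M[R]_(m, n)) (i : 'I_m)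
    (u : nat -> 'cV[R]_n) (z : 'cV[R]_n) :
  u @ \oo --> z -> (A *m u k) i 0 @[k --> \oo] --> (A *m z) i 0.
Proof.
move=> uz.
have dotE x : (A *m x) i 0 = \sum_j (row i A)^T j 0 * x j 0.
  by rewrite mxE; apply: eq_bigr => j _; rewrite !mxE.
rewrite dotE; under eq_fun do rewrite dotE.
by apply: cvg_dot => //; exact: cvg_cst.
Qed.

Lemma mulmx_coord_lim_eq0 (R : realType) (m n : nat) (A : 'M[R]_(m, n))
    (i : 'I_m) (u : nat -> 'cV[R]_n) (z : 'cV[R]_n) :
  u @ \oo --> z ->
  (forall e : R, 0 < e -> \forall k \near \oo, `|(A *m u k) i 0| <= e) ->
  (A *m z) i 0 = 0.
Proof.
move=> uz Au; apply/eqP; rewrite -normr_eq0 eq_le normr_ge0 andbT.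
apply/ler_addgt0Pr => e e0; rewrite add0r.
have Auz : `|(A *m u k) i 0| @[k --> \oo] --> `|(A *m z) i 0|.
  exact: cvg_norm (cvg_mulmx_coord uz).
by apply: (cvgr_to_le Auz); exact: Au.
Qed.

(** Since [S] need not be closed, the infimum of the squared norm is only approached, here within
    1. *)
Lemma exists_almost_min_norm2 (R : realType) (n : nat) (S : set 'cV[R]_n) :
  S !=set0 ->
  exists2 x, S x & forall y, S y -> norm2 x ^+ 2 < norm2 y ^+ 2 + 1.
Proof.
move=> [x0 Sx0]; pose E := [set norm2 x ^+ 2 | x in S].
have Elb : has_lbound E by exists 0 => _ [x _ <-]; exact: sqr_ge0.
have Einf : has_inf E by split => //; exists (norm2 x0 ^+ 2), x0.
have [_ [x Sx <-] xlt] := inf_adherent ltr01 Einf.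
exists x => // y Sy; apply: lt_le_trans xlt _; rewrite lerD2r.
by apply: ge_inf => //; exists y.
Qed.

(** * Small rows on an asymptotically linear set can be made zero *)

Lemma norm2_bounded_of_asymptotically_linear (R : realType) (m n : nat)
    (A : 'M[R]_(m, n)) (I : {set 'I_m}) (C : set 'cV[R]_n) :
  asymptotically_linear C ->
  (forall e : R, 0 < e ->
    exists2 x, C x & forall i, i \in I -> `|(A *m x) i 0| <= e) ->
  exists M : R, forall e : R, 0 < e ->
    exists x, [/\ C x, forall i, i \in I -> `|(A *m x) i 0| <= e
                & norm2 x <= M].
Proof.
move=> [_ _ Cal] CA; apply: contrapT => unbounded.
have far (j : nat) : exists x, [/\ C x,
    forall i, i \in I -> `|(A *m x) i 0| <= 1, j%:R < norm2 x &
    forall y, C y -> (forall i, i \in I -> (A *m y) i 0 = (A *m x) i 0) ->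
      norm2 x ^+ 2 < norm2 y ^+ 2 + 1].
  (* If no such [e] existed, [j] itself would be the bound [M]. *)
  have [e [e0 eM]] : exists e : R, 0 < e /\ forall x, C x ->
      (forall i, i \in I -> `|(A *m x) i 0| <= e) -> j%:R < norm2 x.
    apply: contrapT => H; apply: unbounded; exists j%:R => e e0.
    apply: contrapT => H'; apply: H; exists e; split => // x Cx Ax.
    by rewrite ltNge; apply/negP => xj; apply: H'; exists x.
  (* Below [e], to force norms above [j]; below 1, so that rows [I] stay bounded and vanish in the
     limit after normalization. *)
  pose e' := Num.min e 1.
  have e'0 : 0 < e' by rewrite lt_min e0 ltr01.
  pose S := [set x | C x /\ forall i, i \in I -> `|(A *m x) i 0| <= e'].
  have [|x [Cx Ax] xmin] := @exists_almost_min_norm2 R n S.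
    by have [x Cx Ax] := CA e' e'0; exists x.
  exists x; split => //.
  - by move=> i /Ax; rewrite le_min => /andP[].
  - by apply: eM => // i /Ax; rewrite le_min => /andP[].
  (* A point of [C] with the same rows [I] as [x] is again in [S]. *)
  - move=> y Cy Ayx; apply: xmin; split => // i iI.
    by rewrite Ayx//; exact: Ax.
have [x /all_and4[Cx Ax xj xmin]] := choice far.
have x0 j : 0 < norm2 (x j) by apply: le_lt_trans (xj j); rewrite ler0n.
pose w j := (norm2 (x j))^-1 *: x j.
have w1 j : norm2 (w j) ^+ 2 = 1.
  rewrite sqr_norm2.
  under eq_bigr do rewrite !mxE mulrACA.
  rewrite -mulr_sumr -sqr_norm2 -expr2 -exprMn mulVf ?expr1n//.
  by rewrite gt_eqF.
have [j|xbar [s [js ws]]] := @bounded_subsequence R n 1 w.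
  by rewrite -(@ler_pXn2r _ 2)// ?nnegrE ?norm2_ge0// w1 expr1n.
have xoo : norm2 (x (s j)) @[j --> \oo] --> +oo.
  apply/cvgryPge => M; near=> j.
  apply: le_trans (ltW (xj _)); apply: (@le_trans _ _ j%:R); last first.
    by rewrite ler_nat.
  near: j; exact: nbhs_infty_ger.
have xbar1 : norm2 xbar ^+ 2 = 1.
  have := cvg_dot ws ws.
  under eq_fun do rewrite -sqr_norm2 w1.
  rewrite -sqr_norm2 => w1_cvg.
  by rewrite -(cvg_lim _ w1_cvg)// lim_cst.
have Axbar i : i \in I -> (A *m xbar) i 0 = 0.
  move=> iI; apply: (mulmx_coord_lim_eq0 ws) => e e0.
  near=> j.
  rewrite /w -scalemxAr mxE normrM normfV (ger0_norm (norm2_ge0 _)).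
  rewrite ler_pdivrMl ?x0//; apply: le_trans (Ax _ _ iI) _.
  rewrite -ler_pdivrMr// mul1r.
  near: j; exact: (cvgry_ge xoo).
have [k0 k0C] := Cal 1 (x \o s) xbar ltr01 (fun k => Cx _) xoo ws.
have dot_cvg : \sum_i w (s j) i 0 * xbar i 0 @[j --> \oo] --> (1 : R).
  by rewrite -xbar1 sqr_norm2; exact: (cvg_dot ws (cvg_cst xbar)).
have dot_gt : \forall j \near \oo, 2^-1 < \sum_i w (s j) i 0 * xbar i 0.
  by apply: (cvgr_gt _ dot_cvg); lra.
near \oo => j.
(* The shifted point is in [C] and has the same rows [I], so almost minimality applies to it. *)
have : norm2 (x (s j)) ^+ 2 < norm2 (x (s j) - xbar) ^+ 2 + 1.
  apply: xmin => [|i iI].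
    rewrite -[xbar]scale1r; apply: k0C.
    near: j; exact: nbhs_infty_ge.
  by rewrite mulmxBr mxE [X in _ + X]mxE Axbar // subr0.
have -> : norm2 (x (s j) - xbar) ^+ 2 = norm2 (x (s j)) ^+ 2
    - 2 * (norm2 (x (s j)) * \sum_i w (s j) i 0 * xbar i 0) + norm2 xbar ^+ 2.
  rewrite !sqr_norm2 mulr_sumr mulr_sumr -sumrB -big_split/=.
  apply: eq_bigr => i _; rewrite !mxE; field.
  by rewrite gt_eqF.
(* With [N] the norm and [d] the inner product, the inequality reads [N * d < 1], against [N >= 2]
   and [d > 1/2]. *)
have : 2^-1 < \sum_i w (s j) i 0 * xbar i 0 by near: j.
have : 2 <= norm2 (x (s j)) by near: j; exact: (cvgry_ge xoo).
rewrite xbar1; set N := norm2 _; set d := \sum_i _ => N2 d2.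
by have : 0 < N * (d - 2^-1); [apply: mulr_gt0; lra|lra].
Unshelve. all: by end_near. Qed.

Lemma asymptotically_linear_attains0 (R : realType) (m n : nat)
    (A : 'M[R]_(m, n)) (I : {set 'I_m}) (C : set 'cV[R]_n) :
  asymptotically_linear C ->
  (forall e : R, 0 < e ->
    exists2 x, C x & forall i, i \in I -> `|(A *m x) i 0| <= e) ->
  exists2 x, C x & forall i, i \in I -> (A *m x) i 0 = 0.
Proof.
move=> Cal CA.
have [M CM] := norm2_bounded_of_asymptotically_linear Cal CA.
have /choice[x /all_and3[Cx Ax xM]] (k : nat) := CM k.+1%:R^-1 ltac:(by []).
have [z [s [js xz]]] := bounded_subsequence xM.
case: Cal => _ Ccl _.
exists z; first by apply: closed_cvg xz => //; exact: nearW.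
move=> i iI; apply: (mulmx_coord_lim_eq0 xz) => e e0; near=> k.
apply: le_trans (Ax _ _ iI) _; apply: (@le_trans _ _ k.+1%:R^-1).
  by rewrite lef_pV2 ?posrE// ler_nat ltnS.
apply: ltW; near: k; exact: (near_infty_natSinv_lt (PosNum e0)).
Unshelve. all: by end_near. Qed.

(** * A uniform threshold for the support *)

Definition large_coords (R : realType) (m : nat) (delta : R) (y : 'cV[R]_m) :
    {set 'I_m} :=
  [set i | delta < `|y i 0|]%SET.

Lemma exists_support_threshold (R : realType) (m n : nat) (B : 'M[R]_(m, n))
    (C : set 'cV[R]_n) :
  asymptotically_linear C ->
  exists2 delta : R, 0 < delta & forall x, C x -> exists2 z, C z &
    (norm0 (B *m z) <= #|large_coords delta (B *m x)|)%N.
Proof.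
move=> Cal.
have eP (I : {set 'I_m}) : exists e : R, 0 < e /\
    forall x, C x -> (forall i, i \in I -> `|(B *m x) i 0| <= e) ->
      exists2 z, C z & forall i, i \in I -> (B *m z) i 0 = 0.
  (* If every [e] failed, [C] would contain points with arbitrarily small rows [I], hence one where
     they vanish; that point serves every [x], so [e = 1] would work. *)
  apply: contrapT => noe; apply: (noe); exists 1; split => // x Cx _.
  apply: asymptotically_linear_attains0 => // e e0.
  apply: contrapT => nox; apply: noe; exists e; split => // y Cy Ay.
  by exfalso; apply: nox; exists y.
have [e /all_and2[e0 eC]] := choice eP.
pose delta := \big[Num.min/1]_I e I.
have delta0 : 0 < delta.
  by rewrite /delta; elim/big_ind: _ => // a b a0 b0; rewrite lt_min a0.
exists delta => // x Cx; pose J := large_coords delta (B *m x).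
(* Rows outside [J] are at most [delta <= e (~: J)], so [z] can be chosen with the support of
   [B *m z] inside [J]. *)
have [i|z Cz Bz] := eC (~: J)%SET x Cx.
  by rewrite !inE -leNgt => /le_trans; apply; exact: bigmin_le.
exists z => //; apply/subset_leq_card/fintype.subsetP => i; rewrite inE.
by apply: contraNT => iJ; rewrite Bz// inE.
Qed.

(** * Comparing [psi] with counts of entries *)

Section SeparablePenalty.
Variables (R : realType) (m : nat) (p gamma : R).
Hypotheses (p_gt0 : 0 < p) (gamma_gt0 : 0 < gamma).
Implicit Types y : 'cV[R]_m.

Lemma varphi_ge0 (t : R) : 0 <= varphi p gamma t.
Proof. by rewrite le_min ler01 mulr_ge0 ?powR_ge0 // ltW. Qed.

Lemma varphi_gt0 (t : R) : t != 0 -> 0 < varphi p gamma t.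
Proof. by move=> t0; rewrite lt_min ltr01 mulr_gt0 ?powR_gt0 ?normr_gt0. Qed.

Lemma psi_le_norm0 y : psi p gamma y <= (norm0 y)%:R.
Proof.
rewrite /psi (bigID (fun i => y i 0 != 0))/= [X in _ + X]big1 ?addr0; last first.
  move=> i /negPn/eqP ->.
  by rewrite /varphi normr0 powR0 ?gt_eqF// mulr0 min_l.
rewrite /norm0 -sum1_card natr_sum.
rewrite [leRHS](eq_bigl (fun i => y i 0 != 0)); last by move=> i; rewrite inE.
by apply: ler_sum => i _; rewrite ge_min lexx orbT.
Qed.

Variable delta : R.
Hypotheses (delta_gt0 : 0 < delta) (gamma_large : 1 <= gamma * delta `^ p).

Lemma varphi_eq1 (t : R) : delta < `|t| -> varphi p gamma t = 1.
Proof.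
move=> dt; apply/min_r/(le_trans gamma_large); rewrite ler_pM2l//.
by apply: ge0_ler_powR; rewrite ?nnegrE ?normr_ge0 ?ltW.
Qed.

Lemma psi_split y : psi p gamma y =
  #|large_coords delta y|%:R
  + \sum_(i | ~~ (delta < `|y i 0|)) varphi p gamma (y i 0).
Proof.
rewrite /psi (bigID (fun i => delta < `|y i 0|))/=; congr (_ + _).
rewrite -sum1_card natr_sum; apply: eq_big => [i|i /varphi_eq1//].
by rewrite inE.
Qed.

Lemma card_gt_le_psi y : #|large_coords delta y|%:R <= psi p gamma y.
Proof. by rewrite psi_split lerDl sumr_ge0// => i _; exact: varphi_ge0. Qed.

(** Large entries already account for the whole bound, while any nonzero entry of size at most
    [delta] would add a positive term; so every nonzero entry is large. *)
Lemma norm0_le_card_gt y :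
  psi p gamma y <= #|large_coords delta y|%:R ->
  (norm0 y <= #|large_coords delta y|)%N.
Proof.
rewrite psi_split gerDl => sum_le0.
apply/subset_leq_card/fintype.subsetP => i; rewrite !inE => yi0.
apply/negPn/negP => yi; move: sum_le0; apply/negP; rewrite -ltNge.
rewrite (bigD1 i)//= ltr_pwDl ?varphi_gt0// sumr_ge0// => j _.
exact: varphi_ge0.
Qed.

End SeparablePenalty.

Unset Implicit Arguments.

Theorem theorem6p1 (R : realType) (m n : nat) (B : 'M[R]_(m, n)) (p : R)
    (p_gt0 : 0 < p) (C : set 'cV[R]_n) (C_al : asymptotically_linear C) :
  exists gamma_star : R, 0 < gamma_star /\
    forall gamma : R, gamma_star < gamma ->
      argmin (fun x : 'cV[R]_n => norm0 (B *m x)) C =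
      argmin (fun x : 'cV[R]_n => psi p gamma (B *m x)) C.
Proof.
have [delta delta0 deltaC] := exists_support_threshold B C_al.
have dp0 : 0 < delta `^ p by exact: powR_gt0.
exists (delta `^ p)^-1; split=> [|gamma gammaP]; first by rewrite invr_gt0.
have gamma0 : 0 < gamma by apply: lt_trans gammaP; rewrite invr_gt0.
have large : 1 <= gamma * delta `^ p by rewrite -ler_pdivrMr// div1r ltW.
have psi_le y := @psi_le_norm0 R m p gamma p_gt0 y.
have card_le y := @card_gt_le_psi R m p gamma p_gt0 gamma0 delta delta0 large y.
apply/seteqP; split=> x [Cx xmin]; split=> // y Cy.
  (* For a minimizer [x] of [norm0]: [psi (B x) <= norm0 (B x) <= norm0 (B z) <= #|large_coords
     delta (B y)| <= psi (B y)]. *)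
  have [z Cz zy] := deltaC y Cy.
  apply: le_trans (psi_le _) (le_trans _ (card_le _)).
  by rewrite ler_nat; apply: leq_trans zy; exact: xmin.
(* For a minimizer [x] of [psi], the point [z] is built from [x] itself: [psi (B x) <= psi (B z) <=
   norm0 (B z) <= #|large_coords delta (B x)|], so all nonzero entries of [B x] are large and
   [norm0 (B x) <= psi (B x)]. *)
have [z Cz zx] := deltaC x Cx.
have norm0x : (norm0 (B *m x))%:R <= psi p gamma (B *m x).
  apply: le_trans (card_le _); rewrite ler_nat.
  apply: (norm0_le_card_gt p_gt0 gamma0 delta0 large).
  apply: le_trans (xmin z Cz) _; apply: le_trans (psi_le _) _.
  by rewrite ler_nat.
change (norm0 (B *m x) <= norm0 (B *m y))%N.
rewrite -(ler_nat R); apply: le_trans norm0x _.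
exact: le_trans (xmin y Cy) (psi_le _).
Qed.
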